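(* Let $m,n$ be integers with $1\le n\leq m$, let $q$ be a nonzero complex number that is not a root of unity, and let $x,y\in\mathbb{C}\setminus\{0\}$. Let $\Omega_0\in V_m(x)\otimes V_n(y)$ be the vector $\Omega_0=\frac{[n]_q}{[m+1]_q}\,v_0\otimes w_0$. For integers $0\le j\le l\le n$ put $\phi_{l,j}=e_0^{\,l-j}f^{\,j}\Omega_0$, and for $0\le l\le n$ put $\Delta_l=\{\phi_{l,j}\mid j=0,1,\dots,l\}$. Let $$\Delta=\bigcup_{l=0}^{n-1}\Delta_l\;\cup\;\bigcup_{l=0}^{n-1}f^{\,m+n-2l}\Delta_l\;\cup\;\bigcup_{i=0}^{m-n}f^{\,i}\Delta_n ,$$ where $f^{i}\Delta_l=\{f^{i}\phi_{l,j}\mid \phi_{l,j}\in\Delta_l\}$ for a non-negative integer $i$. Then $\Delta$ is a basis of the vector space $V_m(x)\otimes V_n(y)$ if and only if $y\neq xq^{-m-n+2j}$ for each $j\in\{0,1,\dots,n-1\}$.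
   Context: Notation: $[r]_q=\frac{q^r-q^{-r}}{q-q^{-1}}$. The quantum algebra $U_q(sl_2)$ is the associative algebra over $\mathbb{C}$ with generators $e,f,K,K^{-1}$ and relations $KK^{-1}=K^{-1}K=1$, $KeK^{-1}=q^2e$, $KfK^{-1}=q^{-2}f$, $[e,f]=\frac{K-K^{-1}}{q-q^{-1}}$, with comultiplication $\triangle e=e\otimes K+1\otimes e$, $\triangle f=f\otimes 1+K^{-1}\otimes f$, $\triangle K^{\pm1}=K^{\pm1}\otimes K^{\pm1}$. The quantum affine algebra $U_q(\hat{sl_2})$ is the associative algebra over $\mathbb{C}$ with generators $e_i,f_i,K_i,K_i^{-1}$ ($i=0,1$) and relations $K_iK_i^{-1}=K_i^{-1}K_i=1$, $K_0K_1=K_1K_0$, $K_ie_iK_i^{-1}=q^2e_i$, $K_if_iK_i^{-1}=q^{-2}f_i$, $K_ie_jK_i^{-1}=q^{-2}e_j$ and $K_if_jK_i^{-1}=q^{2}f_j$ for $i\neq j$, $[e_i,f_i]=\frac{K_i-K_i^{-1}}{q-q^{-1}}$, $[e_0,f_1]=[e_1,f_0]=0$, and, for $i\ne j$, $e_i^3e_j-[3]_qe_i^2e_je_i+[3]_qe_ie_je_i^2-e_je_i^3=0$ and $f_i^3f_j-[3]_qf_i^2f_jf_i+[3]_qf_if_jf_i^2-f_jf_i^3=0$. Its comultiplication is $\triangle(e_i)=e_i\otimes K_i+1\otimes e_i$, $\triangle(f_i)=f_i\otimes 1+K_i^{-1}\otimes f_i$, $\triangle(K_i^{\pm1})=K_i^{\pm1}\otimes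 K_i^{\pm1}$. For $x\in\mathbb{C}\setminus\{0\}$ the evaluation map $ev_x:U_q(\hat{sl_2})\to U_q(sl_2)$ is the algebra homomorphism with $ev_x(e_0)=q^{-1}xf$, $ev_x(e_1)=e$, $ev_x(f_0)=qx^{-1}e$, $ev_x(f_1)=f$, $ev_x(K_0)=K^{-1}$, $ev_x(K_1)=K$. For a $U_q(sl_2)$-module $V$, $V(x)$ denotes its pullback along $ev_x$. $V_m$ is the $(m+1)$-dimensional $U_q(sl_2)$-module with basis $v_0,\dots,v_m$ and action $Kv_i=q^{m-2i}v_i$, $fv_i=[i+1]_qv_{i+1}$, $ev_i=[m+1-i]_qv_{i-1}$ (with $v_{-1}=v_{m+1}=0$). $V_n$ is the $(n+1)$-dimensional module defined in the same way (with $n$ in place of $m$), with basis denoted $w_0,\dots,w_n$. $V_m(x)\otimes V_n(y)$ is the vector space $V_m\otimes V_n$ with $g\in U_q(\hat{sl_2})$ acting by $(ev_x\otimes ev_y)\triangle(g)$. On it, $e$ and $f$ (without index) denote the action of $e,f\in U_q(sl_2)$ through $\triangle$, which equals the action of $e_1,f_1$. Explicitly, $e_0$ acts as $q^{-1}(x\,f\otimes K^{-1}+y\,1\otimes f)$ and $f$ acts as $f\otimes 1+K^{-1}\otimes f$. *)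

(* Defs.v *)
From mathcomp Require Import all_boot all_order all_algebra.
From mathcomp Require Import reals.
From mathcomp Require Export complex mxtens.
From mathcomp Require Import ring.

Set Implicit Arguments.
Unset Strict Implicit.
Unset Printing Implicit Defensive.

Import Order.TTheory GRing.Theory Num.Theory.
Local Open Scope ring_scope.

(* A d-dimensional representation of an algebra presented by generators and
   relations is given by one d x d matrix per generator, acting on column
   vectors on the left, subject to the defining relations.  The records below
   collect the matrices, the predicates is_sl2_rep and is_aff_rep the
   relations. *)

Section QuantumAlgebra.

Variables (F : fieldType) (q : F).

Definition qnum (r : int) : F := (q ^ r - q ^ (- r)) / (q - q^-1).

Record sl2_gens (d : nat) := Sl2Gens {
  sl2_e : 'M[F]_d;
  sl2_f : 'M[F]_d;
  sl2_K : 'M[F]_d;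
  sl2_Kinv : 'M[F]_d
}.

Definition is_sl2_rep d (V : sl2_gens d) : Prop :=
  let: Sl2Gens e f K Ki := V in
  [/\ K *m Ki = 1%:M /\ Ki *m K = 1%:M,
      K *m e *m Ki = q ^+ 2 *: e,
      K *m f *m Ki = q ^- 2 *: f
    & e *m f - f *m e = (q - q^-1)^-1 *: (K - Ki)].

Definition sl2_tensor d1 d2 (V : sl2_gens d1) (W : sl2_gens d2) :
    sl2_gens (d1 * d2) :=
  Sl2Gens (sl2_e V *t sl2_K W + 1%:M *t sl2_e W)
          (sl2_f V *t 1%:M + sl2_Kinv V *t sl2_f W)
          (sl2_K V *t sl2_K W)
          (sl2_Kinv V *t sl2_Kinv W).

(* The generators of the affine algebra are indexed by the booleans: false
   is the index 0 and true is the index 1, so that ~~ i is the index j != i. *)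
Record aff_gens (d : nat) := AffGens {
  aff_e : bool -> 'M[F]_d;
  aff_f : bool -> 'M[F]_d;
  aff_K : bool -> 'M[F]_d;
  aff_Kinv : bool -> 'M[F]_d
}.

Definition serre d (a b : 'M[F]_d) : 'M[F]_d :=
  a *m a *m a *m b - qnum 3 *: (a *m a *m b *m a)
  + qnum 3 *: (a *m b *m a *m a) - b *m a *m a *m a.

Definition is_aff_rep d (V : aff_gens d) : Prop :=
  let: AffGens e f K Ki := V in
  K false *m K true = K true *m K false /\
  forall i, [/\ K i *m Ki i = 1%:M /\ Ki i *m K i = 1%:M,
    K i *m e i *m Ki i = q ^+ 2 *: e i /\ K i *m f i *m Ki i = q ^- 2 *: f i,
    K i *m e (~~ i) *m Ki i = q ^- 2 *: e (~~ i) /\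
      K i *m f (~~ i) *m Ki i = q ^+ 2 *: f (~~ i),
    e i *m f i - f i *m e i = (q - q^-1)^-1 *: (K i - Ki i) /\
      e i *m f (~~ i) - f (~~ i) *m e i = 0
  & serre (e i) (e (~~ i)) = 0 /\ serre (f i) (f (~~ i)) = 0].

Definition aff_tensor d1 d2 (V : aff_gens d1) (W : aff_gens d2) :
    aff_gens (d1 * d2) :=
  AffGens (fun i => aff_e V i *t aff_K W i + 1%:M *t aff_e W i)
          (fun i => aff_f V i *t 1%:M + aff_Kinv V i *t aff_f W i)
          (fun i => aff_K V i *t aff_K W i)
          (fun i => aff_Kinv V i *t aff_Kinv W i).

(* The pullback V(x) along the evaluation map ev_x. *)
Definition eval_rep d (x : F) (V : sl2_gens d) : aff_gens d :=
  AffGens (fun i => if i then sl2_e V else (q^-1 * x) *: sl2_f V)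
          (fun i => if i then sl2_f V else (q * x^-1) *: sl2_e V)
          (fun i => if i then sl2_K V else sl2_Kinv V)
          (fun i => if i then sl2_Kinv V else sl2_K V).

Definition basis_vec d (i : 'I_d) : 'cV[F]_d := delta_mx i 0.

(* Column j of each matrix is the image of basis_vec j. *)
Definition irrep (m : nat) : sl2_gens m.+1 :=
  Sl2Gens
    (\matrix_(i, j) if i.+1 == j :> nat then qnum (m.+1%:Z - j%:Z) else 0)
    (\matrix_(i, j) if i == j.+1 :> nat then qnum (j.+1%:Z) else 0)
    (\matrix_(i, j) if i == j then q ^ (m%:Z - 2 * j%:Z) else 0)
    (\matrix_(i, j) if i == j then q ^ (- (m%:Z - 2 * j%:Z)) else 0).

Section TensorProduct.

Variables (m n : nat) (x y : F).

Definition tensor_rep : aff_gens (m.+1 * n.+1) :=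
  aff_tensor (eval_rep x (irrep m)) (eval_rep y (irrep n)).

Definition act_e0 : 'M[F]_(m.+1 * n.+1) := aff_e tensor_rep false.

Definition act_f : 'M[F]_(m.+1 * n.+1) := sl2_f (sl2_tensor (irrep m) (irrep n)).

Definition Omega0 : 'cV[F]_(m.+1 * n.+1) :=
  (qnum n%:Z / qnum m.+1%:Z) *:
    (basis_vec (@ord0 m) *t basis_vec (@ord0 n)).

Definition phi (l j : nat) : 'cV[F]_(m.+1 * n.+1) :=
  act_e0 ^+ (l - j) *m (act_f ^+ j *m Omega0).

Definition Delta_ (l : nat) : seq 'cV[F]_(m.+1 * n.+1) :=
  [seq phi l j | j <- iota 0 l.+1].

(* An enumeration, with possible repetitions, of the set Delta. *)
Definition Delta_seq : seq 'cV[F]_(m.+1 * n.+1) :=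
  flatten [seq Delta_ l | l <- iota 0 n]
  ++ [seq act_f ^+ (m + n - 2 * l) *m v | l <- iota 0 n, v <- Delta_ l]
  ++ [seq act_f ^+ i *m v | i <- iota 0 (m - n).+1, v <- Delta_ n].

Definition Delta : seq 'cV[F]_(m.+1 * n.+1) := undup Delta_seq.

End TensorProduct.

End QuantumAlgebra.

Local Ltac mx_ring :=
  repeat match goal with |- context [mulmx ?A ?B] => move: (mulmx A B) => ? end;
  apply/matrixP=> ? ?; rewrite !mxE; ring.

Section Relations.

Variables (F : fieldType) (q : F).
Hypotheses (q_neq0 : q != 0) (q_sub_neq0 : q - q^-1 != 0).

Let q2_sub_neq0 : q * q - 1 != 0.
Proof.
apply: contraNneq q_sub_neq0 => h; apply/eqP.
by apply: (mulfI q_neq0); rewrite mulrBr mulfV // h mulr0.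
Qed.

Let qnumB (a b : int) : qnum q (a + 1) * qnum q b - qnum q a * qnum q (b + 1) =
  qnum q (b - a).
Proof.
rewrite /qnum !(opprD, opprK) !expfzDr //.
rewrite -[q ^ 1]/q -[q ^ (-1)]/(q^-1) -!invr_expz.
have ha := expfz_neq0 a q_neq0; have hb := expfz_neq0 b q_neq0.
set u := q ^ a in ha *; set v := q ^ b in hb *.
by field; rewrite ha hb q_neq0 q2_sub_neq0.
Qed.

Let qnum0 : qnum q 0 = 0.
Proof. by rewrite /qnum oppr0 subrr mul0r. Qed.

Let qnum3 : qnum q 3 = q ^+ 2 + 1 + q ^- 2.
Proof.
rewrite /qnum -invr_expz -[q ^ 3]/(q ^+ 3).
by field; rewrite q_neq0 q2_sub_neq0.
Qed.

Lemma irrep_rep m : is_sl2_rep q (irrep q m).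
Proof.
pose k := \row_(j < m.+1) q ^ (m%:Z - 2 * j%:Z).
pose k' := \row_(j < m.+1) q ^ (- (m%:Z - 2 * j%:Z)).
rewrite /irrep /=.
have -> : \matrix_(i, j) (if i == j then q ^ (m%:Z - 2 * j%:Z) else 0) = diag_mx k.
  by apply/matrixP=> i j; rewrite !mxE; case: eqP => [->|].
have -> : \matrix_(i, j) (if i == j then q ^ (- (m%:Z - 2 * j%:Z)) else 0) =
    diag_mx k'.
  by apply/matrixP=> i j; rewrite !mxE; case: eqP => [->|].
set e := \matrix_(i, j) _; set f := \matrix_(i, j) _.
split.
- split; apply/matrixP=> i j; rewrite mul_diag_mx !mxE; case: eqP => [->|_] /=;
    by rewrite ?mulr0n ?mulr0 // mulr1n -expfzDr // ?subrr ?addNr expr0z.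
- apply/matrixP=> i j; rewrite mul_mx_diag mul_diag_mx !mxE.
  case: eqP => [ij|_]; last by rewrite !(mulr0, mul0r).
  rewrite mulrAC -expfzDr //; congr (_ * _).
  by rewrite -[q ^+ 2]/(q ^ (2 : int)) -ij; congr (q ^ _); rewrite intS; ring.
- apply/matrixP=> i j; rewrite mul_mx_diag mul_diag_mx !mxE.
  case: eqP => [ij|_]; last by rewrite !(mulr0, mul0r).
  rewrite mulrAC -expfzDr //; congr (_ * _).
  by rewrite -[q ^- 2]/(q ^ (- 2 : int)) ij; congr (q ^ _); rewrite intS; ring.
have ef : e *m f = \matrix_(i, j)
    if i == j then qnum q (m%:Z - j%:Z) * qnum q (j.+1%:Z) else 0.
  apply/matrixP=> i j; rewrite !mxE.
  have [im|im] := ltnP i.+1 m.+1; last first.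
    rewrite big1 => [|l _]; last first.
      by rewrite !mxE gtn_eqF ?mul0r // (leq_trans (ltn_ord l)).
    case: eqP => // <-; have -> : i = m :> nat.
      by apply/eqP; rewrite eqn_leq -ltnS ltn_ord.
    by rewrite subrr qnum0 mul0r.
  rewrite (bigD1 (Ordinal im)) //= big1 ?addr0 => [|l hl]; last first.
    by rewrite !mxE eq_sym ifN ?mul0r.
  rewrite !mxE eqxx /= eqSS -val_eqE; case: eqP => [<-|_]; last by rewrite mulr0.
  by congr (qnum q _ * _); rewrite !intS; ring.
have fe : f *m e = \matrix_(i, j)
    if i == j then qnum q j%:Z * qnum q (m%:Z - j%:Z + 1) else 0.
  apply/matrixP=> i j; rewrite !mxE.
  have [i0|i_gt0] := posnP i.
    rewrite big1 => [|l _]; last by rewrite !mxE i0 mul0r.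
    by case: eqP => // <-; rewrite i0 qnum0 mul0r.
  have im : (i.-1 < m.+1)%N by rewrite (leq_ltn_trans (leq_pred _)).
  rewrite (bigD1 (Ordinal im)) //= big1 ?addr0 => [|l hl]; last first.
    rewrite !mxE ifN ?mul0r //; apply: contraNneq hl => hl.
    by rewrite -val_eqE /= hl.
  rewrite !mxE /= prednK // eqxx -val_eqE; case: eqP => [<-|_]; last by rewrite mulr0.
  by congr (_ * qnum q _); rewrite intS; ring.
apply/matrixP=> i j; rewrite ef fe !mxE.
case: eqP => [->|_]; last by rewrite !mulr0n !subrr mulr0.
rewrite intS [1 + _]addrC [X in X - _]mulrC qnumB !mulr1n /qnum mulrC.
by have -> : m%:Z - j%:Z - j%:Z = m%:Z - 2 * j%:Z by ring.
Qed.

Let conj_qcomm d (K Ki a : 'M[F]_d) (s : F) :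
    s != 0 -> K *m Ki = 1%:M /\ Ki *m K = 1%:M -> K *m a *m Ki = s *: a ->
  [/\ K *m a = s *: (a *m K), a *m K = s^-1 *: (K *m a),
      Ki *m a = s^-1 *: (a *m Ki) & a *m Ki = s *: (Ki *m a)].
Proof.
move=> s0 [h1 h2] h.
have e1 : K *m a = s *: (a *m K).
  by rewrite scalemxAl -h -!mulmxA h2 mulmx1.
have e2 : a *m Ki = s *: (Ki *m a).
  by rewrite scalemxAr -h !mulmxA h2 mul1mx.
by split; rewrite ?e2 ?e1 ?scalerA ?mulVf ?scale1r // e1 scalerA mulVf ?scale1r.
Qed.

Let serreZ d (a b : 'M[F]_d) (s t : F) :
  serre q (s *: a) (t *: b) = (s * s * s * t) *: serre q a b.
Proof.
rewrite /serre -!(scalemxAl, scalemxAr).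
mx_ring.
Qed.

Let serre_comm d (a b : 'M[F]_d) (h k ki : 'M[F]_d) (s : F) :
    s + s^-1 = q ^+ 2 + q ^- 2 ->
    a *m b - b *m a = h -> h = k - ki ->
    k *m a = s *: (a *m k) -> a *m k = s^-1 *: (k *m a) ->
    ki *m a = s^-1 *: (a *m ki) -> a *m ki = s *: (ki *m a) ->
  serre q a b = 0.
Proof.
move=> hs hab hk k1 k2 k3 k4.
have -> : serre q a b = a *m a *m h + h *m a *m a
    - (q ^+ 2 + q ^- 2) *: (a *m h *m a).
  have -> : q ^+ 2 + q ^- 2 = qnum q 3 - 1 by rewrite qnum3; ring.
  rewrite /serre -hab !(mulmxBl, mulmxBr) !mulmxA scalerBr !scalerBl !scale1r.
  mx_ring.
rewrite -hs hk !(mulmxBl, mulmxBr) scalerBr !scalerDl.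
have -> : k *m a *m a = s *: (a *m k *m a) by rewrite k1 -scalemxAl.
have -> : ki *m a *m a = s^-1 *: (a *m ki *m a) by rewrite k3 -scalemxAl.
have -> : a *m a *m k = s^-1 *: (a *m k *m a).
  by rewrite -!mulmxA [a *m k in LHS]k2 -scalemxAr.
have -> : a *m a *m ki = s *: (a *m ki *m a).
  by rewrite -!mulmxA [a *m ki in LHS]k4 -scalemxAr.
mx_ring.
Qed.


Lemma eval_rep_rep d (x : F) (V : sl2_gens F d) :
  x != 0 -> is_sl2_rep q V -> is_aff_rep q (eval_rep q x V).
Proof.
case: V => e f K Ki /= x0 [kk ke kf ef].
have q2_neq0 : q ^+ 2 != 0 by rewrite expf_neq0.
have kk' : Ki *m K = 1%:M /\ K *m Ki = 1%:M by case: kk.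
have qV2_neq0 : q ^- 2 != 0 by rewrite invr_neq0.
have [ke1 ke2 ke3 ke4] := conj_qcomm q2_neq0 kk ke.
have [kf1 kf2 kf3 kf4] := conj_qcomm qV2_neq0 kk kf.
rewrite invrK in kf2 kf3.
have ke' : Ki *m e *m K = q ^- 2 *: e.
  by rewrite ke3 -scalemxAl -mulmxA kk'.1 mulmx1.
have kf' : Ki *m f *m K = q ^+ 2 *: f.
  by rewrite kf3 -scalemxAl -mulmxA kk'.1 mulmx1.
have serre_ef : serre q e f = 0.
  apply: (serre_comm (s := q ^+ 2) (k := (q - q^-1)^-1 *: K)
    (ki := (q - q^-1)^-1 *: Ki) erefl ef); first by rewrite scalerBr.
  - by rewrite -scalemxAl -scalemxAr ke1 !scalerA mulrC.
  - by rewrite -scalemxAl -scalemxAr ke2 !scalerA mulrC.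
  - by rewrite -scalemxAl -scalemxAr ke3 !scalerA mulrC.
  - by rewrite -scalemxAl -scalemxAr ke4 !scalerA mulrC.
have fe : f *m e - e *m f = (q - q^-1)^-1 *: (Ki - K).
  by rewrite -opprB ef -scalerN opprB.
have serre_fe : serre q f e = 0.
  apply: (serre_comm (s := q ^+ 2) (k := (q - q^-1)^-1 *: Ki)
    (ki := (q - q^-1)^-1 *: K) erefl fe); first by rewrite scalerBr.
  - by rewrite -scalemxAl -scalemxAr kf3 !scalerA mulrC.
  - by rewrite -scalemxAl -scalemxAr kf4 !scalerA mulrC.
  - by rewrite -scalemxAl -scalemxAr kf1 !scalerA mulrC.
  - by rewrite -scalemxAl -scalemxAr kf2 !scalerA mulrC.
have serreZl (a b : 'M_d) (s : F) : serre q a b = 0 -> serre q (s *: a) b = 0.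
  by move=> ab; rewrite -[b]scale1r serreZ ab scaler0.
have serreZr (a b : 'M_d) (t : F) : serre q a b = 0 -> serre q a (t *: b) = 0.
  by move=> ab; rewrite -[a]scale1r serreZ ab scaler0.
split; first by rewrite kk.1 kk.2.
have xx : q^-1 * x * (q * x^-1) = 1 by field; rewrite q_neq0 x0.
have sc (c s : F) (A B C : 'M_d) : A *m B *m C = s *: B ->
    A *m (c *: B) *m C = s *: (c *: B).
  by move=> h; rewrite -scalemxAr -scalemxAl h !scalerA mulrC.
case; split=> /=.
- exact: kk.
- by split; [exact: ke | exact: kf].
- by split; apply: sc; [exact: kf | exact: ke].
- split; first exact: ef.
  by rewrite -scalemxAl -scalemxAr subrr.
- by split; apply: serreZr; [exact: serre_ef | exact: serre_fe].
- exact: kk'.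
- by split; apply: sc; [exact: kf' | exact: ke'].
- by split; [exact: ke' | exact: kf'].
- split; last by rewrite -scalemxAl -scalemxAr subrr.
  by rewrite -!(scalemxAl, scalemxAr) !scalerA [q * _ * _]mulrC xx !scale1r fe.
- by split; apply: serreZl; [exact: serre_fe | exact: serre_ef].
Qed.

Let qbr d (c : F) (a z : 'M[F]_d) := a *m z - c *: (z *m a).

Let serre_qbr d (a b : 'M[F]_d) (s : F) :
    s != 0 -> s + s^-1 = q ^+ 2 + q ^- 2 ->
  serre q a b = qbr s^-1 a (qbr 1 a (qbr s a b)).
Proof.
move=> s0 hs; rewrite /serre /qbr.
have -> : qnum q 3 = s + 1 + s^-1 by rewrite qnum3 addrAC -hs addrAC.
rewrite !scale1r !(mulmxBl, mulmxBr, scalerBr) -!(scalemxAl, scalemxAr) !mulmxA.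
rewrite !scalerA mulVf // scale1r.
mx_ring.
Qed.

Let qbrDl d (a b z : 'M[F]_d) (c s r : F) :
    b *m a = s *: (a *m b) -> b *m z = c *: (z *m b) -> s * c = r ->
  qbr c (a + b) z = qbr c a z /\ b *m qbr c a z = r *: (qbr c a z *m b).
Proof.
move=> ba bz <-; split.
  by rewrite /qbr mulmxDl mulmxDr bz scalerDr opprD addrACA subrr addr0.
rewrite /qbr mulmxBr mulmxBl scalerBr -scalemxAr !mulmxA ba bz.
rewrite -!scalemxAl -!mulmxA ba bz -!scalemxAr !scalerA.
by congr (_ *: _ - _ *: _); ring.
Qed.

Let qbrDr d (a b z : 'M[F]_d) (c s r : F) :
    a *m b = s *: (b *m a) -> a *m z = c *: (z *m a) -> s * c = r ->
  qbr c (a + b) z = qbr c b z /\ a *m qbr c b z = r *: (qbr c b z *m a).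
Proof. by rewrite addrC; apply: qbrDl. Qed.

Let serreD d (a b a' b' : 'M[F]_d) (s : F) :
    s != 0 -> s + s^-1 = q ^+ 2 + q ^- 2 ->
    serre q a a' = 0 -> serre q b b' = 0 ->
    b *m a = s^-1 *: (a *m b) -> b *m a' = s *: (a' *m b) ->
    b' *m a = s *: (a *m b') ->
  serre q (a + b) (a' + b') = 0.
Proof.
move=> s0 hs sa sb h1 h2 h3.
have sV0 : s^-1 != 0 by rewrite invr_neq0.
have hsV : s^-1 + s^-1^-1 = q ^+ 2 + q ^- 2 by rewrite invrK addrC.
have -> : serre q (a + b) (a' + b') = serre q (a + b) a' + serre q (a + b) b'.
  by rewrite /serre !(mulmxDr _ a' b') !(mulmxDl, scalerDr); mx_ring.
rewrite (serre_qbr _ a' s0 hs) (serre_qbr _ b' sV0 hsV) invrK.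
have ab : a *m b = s *: (b *m a) by rewrite h1 scalerA mulfV ?scale1r.
have ab' : a *m b' = s^-1 *: (b' *m a) by rewrite h3 scalerA mulVf ?scale1r.
have [-> h4] := qbrDl h1 h2 (mulVf s0).
have [-> h5] := qbrDl h1 h4 (mulr1 _).
have [-> _] := qbrDl h1 h5 erefl.
have [-> h6] := qbrDr ab ab' (mulfV s0).
have [-> h7] := qbrDr ab h6 (mulr1 _).
have [-> _] := qbrDr ab h7 erefl.
by rewrite -serre_qbr // sa add0r -[X in qbr X]invrK -serre_qbr.
Qed.

Lemma aff_tensor_rep d1 d2 (V : aff_gens F d1) (W : aff_gens F d2) :
  is_aff_rep q V -> is_aff_rep q W -> is_aff_rep q (aff_tensor V W).
Proof.
case: V => e f K Ki; case: W => e' f' K' Ki' /= [KK H] [KK' H'].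
have q2_neq0 : q ^+ 2 != 0 by rewrite expf_neq0.
have qV2_neq0 : q ^- 2 != 0 by rewrite invr_neq0.
have KC i : K i *m K (~~ i) = K (~~ i) *m K i by case: i.
have KC' i : K' i *m K' (~~ i) = K' (~~ i) *m K' i by case: i.
have tmul := @tensmx_mul F.
have tZl (c : F) (A : 'M_d1) (B : 'M_d2) : (c *: A) *t B = c *: (A *t B).
  by apply/matrixP=> i j; rewrite !mxE mulrA.
have tZr (c : F) (A : 'M_d1) (B : 'M_d2) : A *t (c *: B) = c *: (A *t B).
  by apply/matrixP=> i j; rewrite !mxE mulrCA.
have tBl (A A' : 'M_d1) (B : 'M_d2) : (A - A') *t B = A *t B - A' *t B.
  by apply/matrixP=> i j; rewrite !mxE mulrBl.
have tBr (A : 'M_d1) (B B' : 'M_d2) : A *t (B - B') = A *t B - A *t B'.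
  by apply/matrixP=> i j; rewrite !mxE mulrBr.
have t11 : (1%:M : 'M[F]_d1) *t (1%:M : 'M[F]_d2) = 1%:M.
  apply/matrixP=> i j; case: (mxtens_indexP i)=> i0 i1.
  case: (mxtens_indexP j)=> j0 j1; rewrite tensmxE !mxE -natrM mulnb.
  by rewrite (can_eq (@mxtens_indexK _ _)).
have serre_tr (a b : 'M_d1) (k l : 'M_d2) : k *m l = l *m k ->
    serre q a b = 0 -> serre q (a *t k) (b *t l) = 0.
  move=> kl sab; have kk : k *m k *m l = k *m l *m k by rewrite -!mulmxA kl.
  have kkk : k *m k *m k *m l = k *m k *m l *m k by rewrite -!mulmxA kl.
  have kl' : l *m k *m k *m k = k *m k *m k *m l.
    by rewrite -kl kkk kk.
  have kl2 : k *m l *m k *m k = k *m k *m k *m l by rewrite kkk kk.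
  rewrite -(tens0mx (k *m k *m k *m l)) -[X in _ = X *t _]sab /serre !tmul kl' kl2 -kkk.
  by apply/matrixP=> i j; rewrite [in RHS]mxE !mxE; ring.
have serre_tl (a b : 'M_d1) (k l : 'M_d2) : a *m b = b *m a ->
    serre q k l = 0 -> serre q (a *t k) (b *t l) = 0.
  move=> ab skl; have kk : a *m a *m b = a *m b *m a by rewrite -!mulmxA ab.
  have kkk : a *m a *m a *m b = a *m a *m b *m a by rewrite -!mulmxA ab.
  have ab' : b *m a *m a *m a = a *m a *m a *m b.
    by rewrite -ab kkk kk.
  have ab2 : a *m b *m a *m a = a *m a *m a *m b by rewrite kkk kk.
  rewrite -(tensmx0 (a *m a *m a *m b)) -[X in _ = _ *t X]skl /serre !tmul ab' ab2 -kkk.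
  by apply/matrixP=> i j; rewrite [in RHS]mxE !mxE; ring.
have KiC i : Ki i *m Ki (~~ i) = Ki (~~ i) *m Ki i.
  have [[a1 a2] _ _ _ _] := H i; have [[b1 b2] _ _ _ _] := H (~~ i).
  have l1 : Ki i *m Ki (~~ i) *m (K (~~ i) *m K i) = 1%:M.
    by rewrite -mulmxA (mulmxA (Ki _) (K _)) b2 mul1mx.
  have l2 : (K (~~ i) *m K i) *m (Ki (~~ i) *m Ki i) = 1%:M.
    by rewrite -KC -mulmxA (mulmxA (K (~~ i))) b1 mul1mx.
  by rewrite -[LHS]mulmx1 -l2 mulmxA l1 mul1mx.
split; first by rewrite !tmul KK KK'.
move=> i.
have [kk [ke kf] [kej kfj] [ef efj] [se sf]] := H i.
have [kk' [ke' kf'] [kej' kfj'] [ef' efj'] [se' sf']] := H' i.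
have [_ _ [kie kif] _ _] := H (~~ i); rewrite negbK in kie kif.
have [kkj _ [kie' kif'] _ _] := H' (~~ i); rewrite negbK in kie' kif'.
have [kkjj _ _ _ _] := H (~~ i).
have [ke1 ke2 ke3 ke4] := conj_qcomm q2_neq0 kk ke.
have [kf1 kf2 kf3 kf4] := conj_qcomm qV2_neq0 kk kf.
have [kej1 kej2 kej3 kej4] := conj_qcomm qV2_neq0 kk kej.
have [kfj1 kfj2 kfj3 kfj4] := conj_qcomm q2_neq0 kk kfj.
have [kie1 kie2 kie3 kie4] := conj_qcomm qV2_neq0 kkjj kie.
have [kif1 kif2 kif3 kif4] := conj_qcomm q2_neq0 kkjj kif.
have [ke1' ke2' ke3' ke4'] := conj_qcomm q2_neq0 kk' ke'.
have [kf1' kf2' kf3' kf4'] := conj_qcomm qV2_neq0 kk' kf'.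
have [kej1' kej2' kej3' kej4'] := conj_qcomm qV2_neq0 kk' kej'.
have [kfj1' kfj2' kfj3' kfj4'] := conj_qcomm q2_neq0 kk' kfj'.
have [kie1' kie2' kie3' kie4'] := conj_qcomm qV2_neq0 kkj kie'.
rewrite ?invrK in kf2 kf3 kej2 kej3 kie2 kie3 kf2' kf3' kej2' kej3' kie2' kie3'.
have conjD (A B C : 'M_d1) (A' B' C' : 'M_d2) (D : 'M_d1) (D' : 'M_d2) (s : F) :
    A *m B *m C = s *: B -> A' *m B' *m C' = B' ->
    A *m D *m C = D -> A' *m D' *m C' = s *: D' ->
    (A *t A') *m (B *t B' + D *t D') *m (C *t C') = s *: (B *t B' + D *t D').
  move=> h1 h2 h3 h4; rewrite mulmxDr mulmxDl !tmul h1 h2 h3 h4.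
  by rewrite tZl tZr scalerDr.
have K1 : K i *m 1%:M *m Ki i = 1%:M by rewrite mulmx1 kk.1.
have K1' : K' i *m 1%:M *m Ki' i = 1%:M by rewrite mulmx1 kk'.1.
have KKi : K i *m Ki i *m Ki i = Ki i by rewrite kk.1 mul1mx.
have KKi' : K' i *m K' i *m Ki' i = K' i by rewrite -mulmxA kk'.1 mulmx1.
have KKj' : K' i *m K' (~~ i) *m Ki' i = K' (~~ i).
  by rewrite KC' -mulmxA kk'.1 mulmx1.
have KKj : K i *m Ki (~~ i) *m Ki i = Ki (~~ i).
  by rewrite -mulmxA -KiC mulmxA kk.1 mul1mx.
have ba (A : 'M_d1) (B C : 'M_d2) (s : F) : B *m C = s *: (C *m B) ->
    (1%:M *t B) *m (A *t C) = s *: ((A *t C) *m (1%:M *t B)).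
  by move=> h; rewrite !tmul mul1mx mulmx1 h tZr.
have ba' (A B : 'M_d1) (C : 'M_d2) (s : F) : A *m B = s *: (B *m A) ->
    (A *t C) *m (B *t 1%:M) = s *: ((B *t 1%:M) *m (A *t C)).
  by move=> h; rewrite !tmul mul1mx mulmx1 h tZl.
have comm_tr (A B C : 'M_d1) (A' B' C' : 'M_d2) (s t : F) :
    A *m C = s *: (C *m A) -> C' *m B' = t *: (B' *m C') -> s * t = 1 ->
    (A *t C' + 1%:M *t A') *m (B *t 1%:M + C *t B')
    - (B *t 1%:M + C *t B') *m (A *t C' + 1%:M *t A') =
    (A *m B - B *m A) *t C' + C *t (A' *m B' - B' *m A').
  move=> h1 h2 st; rewrite !(mulmxDl, mulmxDr) !tmul !(mul1mx, mulmx1) h1 h2.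
  rewrite tZl tZr scalerA st scale1r tBl tBr.
  by apply/matrixP=> k l; rewrite ![in LHS]mxE ![in RHS]mxE; ring.
split.
- by rewrite !tmul kk.1 kk.2 kk'.1 kk'.2 t11.
- by split; apply: conjD=> //; rewrite ?mulmx1 ?kk.1 ?kk'.1 ?mul1mx.
- by split; apply: conjD=> //; rewrite ?mulmx1 ?kk.1 ?kk'.1 ?mul1mx.
- split.
    rewrite (comm_tr _ _ _ _ _ _ _ _ ke4 kf1') ?mulfV // ef ef' !(tZl, tZr) -scalerDr.
    by rewrite tBl tBr addrA subrK.
  rewrite (comm_tr _ _ _ _ _ _ _ _ kie4 kfj1') ?mulVf // efj efj'.
  by rewrite tens0mx tensmx0 addr0.
- split.
    apply: (serreD q2_neq0 erefl).
    + exact: serre_tr.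
    + exact: serre_tl.
    + exact: ba.
    + exact: ba.
    + exact: ba.
  apply: (serreD qV2_neq0).
  + by rewrite invrK addrC.
  + exact: serre_tr.
  + exact: serre_tl.
  + by rewrite invrK; exact: ba'.
  + exact: ba'.
  + exact: ba'.
Qed.

Lemma tensor_rep_rep m n (x y : F) :
  x != 0 -> y != 0 -> is_aff_rep q (tensor_rep q m n x y).
Proof.
by move=> x0 y0; apply: aff_tensor_rep; apply: eval_rep_rep=> //;
  apply: irrep_rep.
Qed.

End Relations.

Lemma act_fE (F : fieldType) (q : F) m n (x y : F) :
  act_f q m n = aff_f (tensor_rep q m n x y) true.
Proof. by []. Qed.

Lemma act_e0E (F : fieldType) (q : F) m n (x y : F) :
  act_e0 q m n x y =
  q^-1 *: (x *: (sl2_f (irrep q m) *t sl2_Kinv (irrep q n))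
           + y *: (1%:M *t sl2_f (irrep q n))).
Proof.
rewrite /act_e0 /tensor_rep /aff_tensor /eval_rep.
move: (irrep q m) (irrep q n) => V W /=.
by apply/matrixP=> i j; rewrite !mxE; ring.
Qed.

(* Main.v *)
Require Import Defs.
From mathcomp Require Import all_boot all_order all_algebra.
From mathcomp Require Import reals.
From mathcomp Require Import ring zify.
Import GRing.Theory.
Local Open Scope ring_scope.

(* Delta has at most (m+1)(n+1) elements, so it is a basis iff no nonzero
   linear form vanishes on it.  Put u_(i,k) = f^i v_0 (x) f^k w_0, of level
   i + k.  For l <= n the forms on level l that vanish on the image of e_0 are
   the multiples of lambda_l(u_(i,k)) = prod_(t<k) (- (x/y) q^(2t-n)), and
     lambda_(l+1) o f = (1 - (x/y) q^(-m-n+2l)) lambda_l.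
   Hence lambda_l(f^l Omega_0) is, up to a nonzero scalar,
   prod_(t<l) (1 - (x/y) q^(-m-n+2t)): if one of the factors with l = n is 0,
   then lambda_n kills Delta, and otherwise Delta_l spans level l for every
   l <= n, by induction on l.  The other levels then follow from two facts on
   the action of f: it is onto from each level >= n to the next one, and
   f^(m+n-2l) is onto from level l to level m+n-l. *)

(** * Spanning families and the linear forms vanishing on them *)

Section Annihilator.

Set Implicit Arguments.
Unset Strict Implicit.

Variable F : fieldType.

(** If only the zero form vanishes on [X], the matrix [A] with columns [X] is row free, and a right
    inverse [B] yields coordinates [B *m v] of any [v]. *)
Lemma span_fullP (d : nat) (X : seq 'cV[F]_d) :
  <<X>>%VS = fullv <->
  forall mu : 'rV[F]_d, {in X, forall v, mu *m v = 0} -> mu = 0.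
Proof.
pose A : 'M[F]_(d, size X) := \matrix_(i, j) X`_j i 0.
have colA j : col j A = X`_j by apply/colP => i; rewrite !mxE.
split=> [spanX mu muX | annX].
  suff muv (v : 'cV_d) : mu *m v = 0.
    apply/rowP => i; move/matrixP/(_ 0 0): (muv (delta_mx i 0)).
    rewrite !mxE (bigD1 i) //= big1 => [|j ji]; last first.
      by rewrite mxE (negbTE ji) mulr0.
    by rewrite mxE !eqxx mulr1 addr0.
  have: v \in <<in_tuple X>>%VS by rewrite /= spanX memvf.
  move/coord_span => ->; rewrite mulmx_sumr big1 // => i _.
  by rewrite -scalemxAr muX ?scaler0 // mem_nth.
have /row_freeP[B AB] : row_free A.
  apply: inj_row_free => mu muA; apply: annX => v vX.
  have iX : (index v X < size X)%N by rewrite index_mem.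
  have -> : v = col (Ordinal iX) A by rewrite colA nth_index.
  by rewrite colE mulmxA muA mul0mx.
apply/eqP; rewrite eqEsubv subvf; apply/subvP => v _.
have -> : v = \sum_j (B *m v) j 0 *: X`_j.
  rewrite -[LHS]mul1mx -AB -mulmxA; apply/colP => i.
  rewrite mxE summxE; apply: eq_bigr => j _.
  by rewrite [in RHS]mxE -colA !mxE mulrC.
by apply: memv_suml => j _; rewrite memvZ // memv_span // mem_nth.
Qed.

End Annihilator.

(** * Quantum integers off roots of unity, and the vectors f^i v_0 *)

Section Tensor.

Set Implicit Arguments.
Unset Strict Implicit.

Variables (F : fieldType) (q : F).
Hypotheses (q_neq0 : q != 0) (q_gen : forall k : nat, (0 < k)%N -> q ^+ k != 1).

Lemma exprz_neq1 (z : int) : z != 0 -> q ^ z != 1.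
Proof.
case: z => [[//|k]|k] _; first exact: q_gen.
by rewrite NegzE -invr_expz invr_eq1; exact: q_gen.
Qed.

Lemma exprz_inj (a b : int) : q ^ a = q ^ b -> a = b.
Proof.
move=> ab; apply/eqP; rewrite -subr_eq0; apply: contraTT isT => /exprz_neq1.
by rewrite expfzDr // ab -expfzDr // subrr expr0z eqxx.
Qed.

Lemma qq1_neq0 : q * q - 1 != 0.
Proof. by rewrite subr_eq0 -expr2 q_gen. Qed.

Lemma qsubV_neq0 : q - q^-1 != 0.
Proof.
apply: contraNneq qq1_neq0 => h; apply/eqP.
by apply: (mulfI (invr_neq0 q_neq0)); rewrite mulrBr mulKf // mulr1 h mulr0.
Qed.

Lemma qnum_neq0 (z : int) : z != 0 -> qnum q z != 0.
Proof.
move=> z0; rewrite mulf_neq0 ?invr_neq0 ?qsubV_neq0 // subr_eq0.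
by apply: contra_neq z0 => /exprz_inj h; lia.
Qed.

(** Scaled so that f is a plain shift: this is [i]_q! v_i for i <= d and 0 for i > d. *)
Definition lower (d i : nat) : 'cV[F]_d.+1 :=
  sl2_f (irrep q d) ^+ i *m basis_vec F ord0.

Lemma lowerS d i : sl2_f (irrep q d) *m lower d i = lower d i.+1.
Proof. by rewrite /lower exprS -mulmxA. Qed.

Definition qfact (i : nat) : F := \prod_(j < i) qnum q j.+1%:Z.

Lemma qfact_neq0 i : qfact i != 0.
Proof. by apply/prodf_neq0 => j _; exact: qnum_neq0. Qed.

Lemma lowerE d i (a : 'I_d.+1) b : lower d i a b = (a == i :> nat)%:R * qfact i.
Proof.
rewrite ord1 {b}; elim: i a => [|i IH] a.
  by rewrite /lower expr0 mul1mx mxE andbT /qfact big_ord0 mulr1 -val_eqE.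
rewrite -lowerS mxE; under eq_bigr => j _ do rewrite IH mxE.
have [ai|ai] := eqVneq (a : nat) i.+1.
  have id : (i < d.+1)%N by rewrite ltnW // -ai.
  rewrite (bigD1 (Ordinal id)) //= big1 ?addr0 => [|j ji]; last first.
    by rewrite [j == i :> nat](negbTE ji) mul0r mulr0.
  by rewrite ai !eqxx !mul1r /qfact big_ord_recr mulrC.
rewrite big1 ?mul0r // => j _; have [ji|_] := eqVneq (j : nat) i.
  by rewrite ji (negbTE ai) mul0r.
by rewrite mul0r mulr0.
Qed.

Lemma lower_K d i :
  sl2_K (irrep q d) *m lower d i = q ^ (d%:Z - 2 * i%:Z) *: lower d i.
Proof.
apply/colP => a; rewrite mxE [RHS]mxE (bigD1 a) //= big1 ?addr0 => [|j ja].
  by rewrite mxE eqxx !lowerE; have [->|_] := eqVneq (a : nat) i;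
    rewrite ?mul0r ?mulr0.
by rewrite mxE eq_sym (negbTE ja) mul0r.
Qed.

Lemma lower_Kinv d i :
  sl2_Kinv (irrep q d) *m lower d i = q ^ (- (d%:Z - 2 * i%:Z)) *: lower d i.
Proof.
apply/colP => a; rewrite mxE [RHS]mxE (bigD1 a) //= big1 ?addr0 => [|j ja].
  by rewrite mxE eqxx !lowerE; have [->|_] := eqVneq (a : nat) i;
    rewrite ?mul0r ?mulr0.
by rewrite mxE eq_sym (negbTE ja) mul0r.
Qed.

(** * The products u_(i,k) and the values of linear forms on them *)

Variables m n : nat.
Let D := (m.+1 * n.+1)%N.

Definition uvec (i k : nat) : 'cV[F]_D := lower m i *t lower n k.

(** Forms are row vectors, so operators act on them from the right. Indices run over all of [nat];
    values outside the rectangle i <= m, k <= n are 0. *)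
Definition uval (mu : 'rV[F]_D) (i k : nat) : F := (mu *m uvec i k) 0 0.

Lemma tensZl a b c d (s : F) (A : 'M_(a, b)) (B : 'M_(c, d)) :
  (s *: A) *t B = s *: (A *t B).
Proof. by apply/matrixP => i j; rewrite !mxE mulrA. Qed.

Lemma tensZr a b c d (s : F) (A : 'M_(a, b)) (B : 'M_(c, d)) :
  A *t (s *: B) = s *: (A *t B).
Proof. by apply/matrixP => i j; rewrite !mxE mulrCA. Qed.

Lemma uval_f mu i k : uval (mu *m act_f q m n) i k =
  uval mu i.+1 k + q ^ (2 * i%:Z - m%:Z) * uval mu i k.+1.
Proof.
rewrite /uval -mulmxA; have -> : act_f q m n *m uvec i k =
    uvec i.+1 k + q ^ (2 * i%:Z - m%:Z) *: uvec i k.+1.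
  rewrite mulmxDl !(tensmx_mul _ _ (lower m i) (lower n k)) mul1mx !lowerS.
  by rewrite lower_Kinv opprB tensZl.
by rewrite mulmxDr -scalemxAr !mxE.
Qed.

Lemma uval_e0 x y mu i k : uval (mu *m act_e0 q m n x y) i k = q^-1 *
  (x * q ^ (2 * k%:Z - n%:Z) * uval mu i.+1 k + y * uval mu i k.+1).
Proof.
rewrite /uval -mulmxA; have -> : act_e0 q m n x y *m uvec i k = q^-1 *:
    (x *: (q ^ (2 * k%:Z - n%:Z) *: uvec i.+1 k) + y *: uvec i k.+1).
  rewrite act_e0E -scalemxAl mulmxDl -!scalemxAl.
  rewrite !(tensmx_mul _ _ (lower m i) (lower n k)) mul1mx !lowerS.
  by rewrite lower_Kinv opprB tensZr.
by rewrite -scalemxAr mulmxDr -!scalemxAr !mxE mulrA.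
Qed.

Lemma uval_K mu i k :
  uval (mu *m sl2_K (sl2_tensor (irrep q m) (irrep q n))) i k =
  q ^ (m%:Z + n%:Z - 2 * (i + k)%:Z) * uval mu i k.
Proof.
rewrite /uval -mulmxA (tensmx_mul _ _ (lower m i) (lower n k)) !lower_K.
rewrite tensZl tensZr scalerA -scalemxAr mxE -expfzDr //.
by congr (q ^ _ * _); lia.
Qed.

Lemma uvecE i k (s : 'I_D) t : uvec i k s t =
  ((mxtens_unindex s).1 == i :> nat)%:R * ((mxtens_unindex s).2 == k :> nat)%:R
  * (qfact i * qfact k).
Proof. by rewrite /uvec mxE !lowerE mulrACA. Qed.

Lemma uval_out mu i k : ~~ ((i <= m) && (k <= n))%N -> uval mu i k = 0.
Proof.
move=> ik; rewrite /uval (_ : uvec i k = 0) ?mulmx0 ?mxE //.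
apply/colP => s; rewrite uvecE mxE.
rewrite -natrM mulnb; case: andP => [[/eqP h1 /eqP h2]|_];
  last by rewrite mul0r.
by case/negP: ik; rewrite -h1 -h2;
  rewrite -[X in X && _]ltnS -[X in _ && X]ltnS !ltn_ord.
Qed.

Lemma uvalE mu i k (im : (i < m.+1)%N) (kn : (k < n.+1)%N) : uval mu i k =
  mu 0 (mxtens_index (Ordinal im, Ordinal kn)) * (qfact i * qfact k).
Proof.
rewrite /uval mxE (bigD1 (mxtens_index (Ordinal im, Ordinal kn))) //=.
rewrite uvecE mxtens_indexK !eqxx !mul1r big1 ?addr0 // => s sik.
rewrite uvecE -natrM mulnb; case: andP => [[/eqP hi /eqP hk]|_];
  last by rewrite mul0r mulr0.
case/eqP: sik; rewrite -[s]mxtens_unindexK; congr mxtens_index.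
by case: (mxtens_unindex s) hi hk => a b /= ? ?; congr (_, _); apply: val_inj.
Qed.

Lemma uval_eq0 mu : (forall i k, uval mu i k = 0) -> mu = 0.
Proof.
move=> mu0; apply/rowP => s; case: (mxtens_indexP s) => -[i im] [k kn].
move/eqP: (mu0 i k); rewrite uvalE !mulf_eq0 !(negbTE (qfact_neq0 _)) !orbF.
by move/eqP->; rewrite mxE.
Qed.

(** Inside the rectangle the u_(i,k) are nonzero multiples of the standard basis, so values there
    can be prescribed freely. *)
Lemma uval_surj (g : nat -> nat -> F) :
  (forall i k, ~~ ((i <= m) && (k <= n))%N -> g i k = 0) ->
  exists mu, forall i k, uval mu i k = g i k.
Proof.
move=> g0.
pose G (a : 'I_m.+1 * 'I_n.+1) :=
  g a.1 a.2 / (qfact a.1 * qfact a.2).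
exists (\row_s G (mxtens_unindex s)) => i k.
have [/andP[im kn]|ik] := boolP ((i < m.+1) && (k < n.+1))%N; last first.
  by rewrite g0 ?uval_out.
by rewrite uvalE mxE mxtens_indexK /G /= divfK // mulf_neq0 ?qfact_neq0.
Qed.

Lemma uvalD mu nu i k : uval (mu + nu) i k = uval mu i k + uval nu i k.
Proof. by rewrite /uval mulmxDl mxE. Qed.

Lemma uvalB mu nu i k : uval (mu - nu) i k = uval mu i k - uval nu i k.
Proof. by rewrite /uval mulmxBl !mxE. Qed.

Lemma uvalZ c mu i k : uval (c *: mu) i k = c * uval mu i k.
Proof. by rewrite /uval -scalemxAl !mxE. Qed.

Lemma uval0 i k : uval 0 i k = 0.
Proof. by rewrite /uval mul0mx mxE. Qed.

End Tensor.

(** * Injectivity of powers of f on weight forms, as in hard Lefschetz *)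

Section Lefschetz.

Set Implicit Arguments.
Unset Strict Implicit.

Variables (F : fieldType) (q : F).
Hypotheses (q_neq0 : q != 0) (q_gen : forall k : nat, (0 < k)%N -> q ^+ k != 1).

Variables (d : nat) (V : sl2_gens F d).
Hypothesis V_rep : is_sl2_rep q V.

Lemma mulmxXSr p (mu : 'M[F]_(p, d)) (A : 'M[F]_d) k :
  mu *m A ^+ k.+1 = mu *m A ^+ k *m A.
Proof. by rewrite exprSr mulmxA. Qed.

Notation e := (sl2_e V).
Notation f := (sl2_f V).
Notation K := (sl2_K V).
Notation Ki := (sl2_Kinv V).

(** The hypothesis makes [mu] vanish on all weight vectors of weight other than h; since e raises
    weights by 2, composing with it lowers h by 2. *)
Lemma row_weight_e (mu : 'rV[F]_d) (h : int) :
  mu *m K = q ^ h *: mu -> mu *m e *m K = q ^ (h - 2) *: (mu *m e).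
Proof.
case: V V_rep => e f K Ki /= [[_ KiK] ke _ _] muK.
have eK : e *m K = q ^- 2 *: (K *m e).
  by rewrite -[in RHS](mulmx1 (K *m e)) -KiK mulmxA ke -scalemxAl scalerA mulVf
    ?scale1r // expf_neq0.
by rewrite -mulmxA eK -scalemxAr mulmxA muK -scalemxAl scalerA mulrC expfzDr.
Qed.

Lemma row_weight_f (mu : 'rV[F]_d) (h : int) :
  mu *m K = q ^ h *: mu -> mu *m f *m K = q ^ (h + 2) *: (mu *m f).
Proof.
case: V V_rep => e f K Ki /= [[_ KiK] _ kf _] muK.
have fK : f *m K = q ^+ 2 *: (K *m f).
  by rewrite -[in RHS](mulmx1 (K *m f)) -KiK mulmxA kf -scalemxAl scalerA mulfV
    ?scale1r // expf_neq0.
by rewrite -mulmxA fK -scalemxAr mulmxA muK -scalemxAl scalerA mulrC expfzDr.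
Qed.

Lemma row_weight_fX (mu : 'rV[F]_d) (h : int) (k : nat) :
  mu *m K = q ^ h *: mu ->
  mu *m f ^+ k *m K = q ^ (h + 2 * k%:Z) *: (mu *m f ^+ k).
Proof.
move=> muK; elim: k => [|k IH]; first by rewrite expr0 mulmx1 mulr0 addr0.
rewrite exprSr mulmxA (row_weight_f IH); congr (q ^ _ *: _); lia.
Qed.

Lemma row_commutator (mu : 'rV[F]_d) (h : int) :
  mu *m K = q ^ h *: mu -> mu *m e *m f = mu *m f *m e + qnum q h *: mu.
Proof.
case: V V_rep => e f K Ki /= [[KKi _] _ _ ef] muK.
have muKi : mu *m Ki = q ^ (- h) *: mu.
  rewrite -[in RHS](mulmx1 mu) -KKi mulmxA muK -scalemxAl scalerA -expfzDr //.
  by rewrite addNr scale1r.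
apply/eqP; rewrite addrC -subr_eq -!mulmxA -mulmxBr ef -scalemxAr mulmxBr.
by rewrite muK muKi -scalerBl scalerA mulrC.
Qed.

Lemma qnum_step (k h : int) :
  qnum q (k + 1) * qnum q h + qnum q (h + k + 2) =
  qnum q (k + 2) * qnum q (h + 1).
Proof.
rewrite /qnum !opprD !expfzDr // -![q ^ (- _)]invr_expz.
have hk := expfz_neq0 k q_neq0; have hh := expfz_neq0 h q_neq0.
set u := q ^ k in hk *; set v := q ^ h in hh *.
rewrite -[q ^ 1]/q.
by field; rewrite hk hh q_neq0 qq1_neq0.
Qed.

(** Moving e past one further f adds [h+2k+2]_q, which [qnum_step] absorbs into the product of two
    quantum integers. *)
Lemma row_commutator_fX (mu : 'rV[F]_d) (h : int) (k : nat) :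
  mu *m K = q ^ h *: mu ->
  mu *m e *m f ^+ k.+1 =
  mu *m f ^+ k.+1 *m e + (qnum q k.+1%:Z * qnum q (h + k%:Z)) *: (mu *m f ^+ k).
Proof.
move=> muK; elim: k => [|k IH].
  rewrite expr1 expr0 mulmx1 addr0 (row_commutator muK).
  rewrite [qnum q 1]mulfV ?mul1r //.
  exact: qsubV_neq0.
rewrite mulmxXSr IH mulmxDl -scalemxAl -mulmxXSr (mulmxXSr _ _ k.+1).
rewrite (row_commutator (row_weight_fX _ muK)) -addrA -scalerDl.
rewrite [X in X *: _]addrC; congr (_ + _ *: _).
have -> : h + 2 * k.+1%:Z = h + k%:Z + k%:Z + 2 by lia.
have -> : h + k.+1%:Z = h + k%:Z + 1 by lia.
have -> : k.+2%:Z = k%:Z + 2 by lia.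
have -> : k.+1%:Z = k%:Z + 1 by lia.
exact: qnum_step.
Qed.

(* Moving e through f^(k+1) shows that mu e is killed by f^(k+2); by induction
   on the weight mu e = 0, and the commutator then gives mu f^k = 0. *)
Lemma row_lefschetz (N : nat) :
  (forall mu : 'rV[F]_d, mu *m K = q ^ (- N%:Z - 2) *: mu -> mu = 0) ->
  forall (l k : nat) (mu : 'rV[F]_d), (k + 2 * l <= N)%N ->
  mu *m K = q ^ (2 * l%:Z - N%:Z) *: mu -> mu *m f ^+ k = 0 -> mu = 0.
Proof.
move=> lowest; elim/ltn_ind=> l IHl; elim=> [|k IHk] mu kN muK muf.
  by rewrite -[mu]mulmx1.
have mue : mu *m e = 0.
  case: l IHl {IHk} kN muK => [|l] IHl kN muK.
    apply: lowest; rewrite (row_weight_e muK); congr (q ^ _ *: _); lia.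
  apply: (IHl l _ k.+2) => //; first by lia.
    rewrite (row_weight_e muK); congr (q ^ _ *: _); lia.
  by rewrite (row_commutator_fX k.+1 muK) (mulmxXSr _ _ k.+1) muf !mul0mx scaler0
    addr0.
have := row_commutator_fX k muK; rewrite mue muf !mul0mx add0r => /esym/eqP.
(* The coefficient is [k+1]_q [2l-N+k]_q, and k + 1 + 2l <= N makes the second argument negative. *)
rewrite scaler_eq0 mulf_eq0 !(negbTE (qnum_neq0 _ _ _)) //=; last by lia.
by move/eqP; apply: IHk => //; lia.
Qed.

End Lefschetz.

(** * Levels of the tensor product and the action of f between them *)

Section Levels.

Set Implicit Arguments.
Unset Strict Implicit.

Variables (F : fieldType) (q : F) (m n : nat).
Hypotheses (q_neq0 : q != 0) (q_gen : forall k : nat, (0 < k)%N -> q ^+ k != 1).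
Hypothesis n_le_m : (n <= m)%N.

Local Notation row := 'rV[F]_(m.+1 * n.+1).
Local Notation f := (act_f q m n).
Local Notation uval := (@uval F q m n).

(** K acts on level p by q^(m+n-2p), so levels are weight spaces. *)
Definition kills (mu : row) (p : nat) :=
  forall i k, (i + k)%N = p -> uval mu i k = 0.

Lemma kills_eq0 mu : (forall p, kills mu p) -> mu = 0.
Proof.
by move=> mu0; apply: (uval_eq0 q_neq0 q_gen) => i k; exact: (mu0 (i + k)%N).
Qed.

Lemma kills_f mu p : kills mu p.+1 -> kills (mu *m f) p.
Proof.
move=> mu0 i k ik; rewrite uval_f // !mu0 ?mulr0 ?addr0 //; lia.
Qed.

Lemma kills_fX mu p t : kills mu (p + t)%N -> kills (mu *m f ^+ t) p.
Proof.
elim: t p => [|t IH] p mu0; first by rewrite expr0 mulmx1; rewrite addn0 in mu0.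
by rewrite mulmxXSr; apply: kills_f; apply: IH; rewrite addSnnS.
Qed.

(** Dual to f being onto from level p to level p+1. Induction on i: u_(0,p+1) = 0 as p+1 > n, and
    u_(i+1,k) is f u_(i,k) minus a multiple of u_(i,k+1). *)
Lemma kills_f_inv mu p : (n <= p)%N -> kills (mu *m f) p -> kills mu p.+1.
Proof.
move=> np muf; elim=> [|i IH] k ik; first by apply: uval_out => //; lia.
have := muf i k (succn_inj ik); rewrite uval_f // IH ?mulr0 ?addr0 //; lia.
Qed.

Lemma kills_fX_inv mu p t :
  (n <= p)%N -> kills (mu *m f ^+ t) p -> kills mu (p + t)%N.
Proof.
elim: t p => [|t IH] p np; first by rewrite expr0 mulmx1 addn0.
rewrite mulmxXSr -addSnnS => /(kills_f_inv np); apply: IH; lia.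
Qed.

Definition restrict_spec mu p (nu : row) :=
  forall i k, uval nu i k = if (i + k == p)%N then uval mu i k else 0.

Lemma restrict_ex mu p : exists nu, restrict_spec mu p nu.
Proof.
apply: uval_surj => // i k ik; case: eqP => // _; exact: uval_out.
Qed.

(** Dual to f^(m+n-2l) being onto from level l to level m+n-l. Cutting [mu] down to level m+n-l
    gives a weight form killed by that power of f, to which [row_lefschetz] applies. *)
Lemma kills_fX_inv_high mu l : (l <= n)%N ->
  kills (mu *m f ^+ (m + n - 2 * l)) l -> kills mu (m + n - l)%N.
Proof.
move=> ln muf; have [nu nuE] := restrict_ex mu (m + n - l)%N.
have valB0 p : p = (m + n - l)%N -> kills (nu - mu) p.
  by move=> -> i k ik; rewrite uvalB nuE ik eqxx subrr.
have nu0 p : p <> (m + n - l)%N -> kills nu p.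
  by move=> np i k ik; rewrite nuE ik; case: eqP.
have nuf : nu *m f ^+ (m + n - 2 * l) = 0.
  apply: kills_eq0 => p; have [->|pl] := eqVneq p l.
    move=> i k ik; rewrite -[nu](subrK mu) mulmxDl uvalD muf // addr0.
    apply: kills_fX ik.
    apply: valB0; lia.
  apply: kills_fX; apply: nu0; lia.
(* The generators of index 1 do not involve x and y, so the affine relations are taken at x = y =
   1. *)
have rep : is_sl2_rep q (sl2_tensor (irrep q m) (irrep q n)).
  have := tensor_rep_rep q_neq0 (qsubV_neq0 q_neq0 q_gen) m n
    (oner_neq0 F) (oner_neq0 F).
  move=> [_ /(_ true)] [KK [ke kf] _ [ef _] _].
  by split.
have {}nuf : nu = 0.
  apply: (row_lefschetz q_neq0 q_gen rep (N := (m + n)%N) _ (l := l) _ _ nuf).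
  (* Weight -m-n-2 would force i + k = m + n + 1, outside the rectangle. *)
  - move=> xi xiK; apply: (uval_eq0 q_neq0 q_gen) => i k.
    have [/andP[im kn]|/uval_out -> //] := boolP ((i <= m) && (k <= n))%N.
    have := uval_K q_neq0 xi i k; rewrite xiK uvalZ => /eqP.
    rewrite -subr_eq0 -mulrBl mulf_eq0 => /orP[|/eqP//].
    by rewrite subr_eq0 => /eqP /(exprz_inj q_neq0 q_gen); lia.
  - lia.
  - apply/eqP; rewrite -subr_eq0; apply/eqP.
    apply: (uval_eq0 q_neq0 q_gen) => i k; rewrite uvalB uval_K // uvalZ nuE.
    case: eqP => [ik|_]; last by rewrite !mulr0 subrr.
    apply/eqP; rewrite subr_eq0; apply/eqP; congr (_ * _).
    congr (q ^ _); lia.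
by move=> i k ik; have := nuE i k; rewrite nuf uval0 ik eqxx.
Qed.

(** * The forms lambda_l, with z = x/y *)

Definition lam_val (z : F) (l i k : nat) : F :=
  if (i + k == l)%N then \prod_(t < k) (- z * q ^ (2 * t%:Z - n%:Z)) else 0.

Definition lam_spec z l (lam : row) :=
  forall i k, uval lam i k = lam_val z l i k.

Lemma lam_ex z l : (l <= n)%N -> exists lam, lam_spec z l lam.
Proof.
move=> ln; apply: uval_surj => // i k ik; rewrite /lam_val ifN //; lia.
Qed.

(** The product satisfies y lambda(u_(i,k+1)) = - x q^(2k-n) lambda(u_(i+1,k)), which by [uval_e0]
    says that lambda vanishes on e_0 u_(i,k). *)
Lemma lam_e0 (x y : F) l lam : y != 0 -> lam_spec (x / y) l lam ->
  lam *m act_e0 q m n x y = 0.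
Proof.
move=> y0 lamE; apply: (uval_eq0 q_neq0 q_gen) => i k.
rewrite uval_e0 // !lamE /lam_val addSnnS; case: eqP => _;
  last by rewrite !mulr0 addr0 mulr0.
by rewrite big_ord_recr /=; field; rewrite y0.
Qed.

(** The two terms of f u_(i,k) contribute 1 and - z q^(2i-m) q^(2k-n) times lambda_l(u_(i,k)); as i
    + k = l, the exponent depends on l only. *)
Lemma lam_f z l lam lam' : lam_spec z l lam -> lam_spec z l.+1 lam' ->
  lam' *m f = (1 - z * q ^ (- m%:Z - n%:Z + 2 * l%:Z)) *: lam.
Proof.
move=> lamE lamE'; apply/eqP; rewrite -subr_eq0; apply/eqP.
apply: (uval_eq0 q_neq0 q_gen) => i k.
rewrite uvalB uvalZ uval_f // !lamE' lamE /lam_val -addSnnS addSn eqSS.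
case: eqP => [ik|_]; last by rewrite !mulr0 addr0 subr0.
have -> : - m%:Z - n%:Z + 2 * l%:Z =
    (2 * i%:Z - m%:Z) + (2 * k%:Z - n%:Z) by lia.
rewrite [q ^ (_ + (2 * k%:Z - _))]expfzDr // big_ord_recr /=; ring.
Qed.

Lemma lam_fX z l lam : (l <= n)%N -> lam_spec z l lam ->
  uval (lam *m f ^+ l) 0 0 =
  \prod_(t < l) (1 - z * q ^ (- m%:Z - n%:Z + 2 * t%:Z)).
Proof.
elim: l lam => [|l IH] lam ln lamE.
  by rewrite expr0 mulmx1 lamE /lam_val eqxx !big_ord0.
have [lam' lamE'] := lam_ex z (ltnW ln).
rewrite exprS mulmxA (lam_f lamE' lamE) -scalemxAl uvalZ IH // ?(ltnW ln) //.
by rewrite big_ord_recr mulrC.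
Qed.

Lemma phi_ll (x y : F) l (mu : row) :
  mu *m phi q m n x y l l =
  (qnum q n%:Z / qnum q m.+1%:Z) *: (mu *m f ^+ l *m uvec q m n 0 0).
Proof.
rewrite /phi subnn expr0 mul1mx mulmxA /Omega0 -scalemxAr /uvec /lower !expr0.
by rewrite !mul1mx.
Qed.

(** The coefficient [n]_q/[m+1]_q of Omega_0 is nonzero because n >= 1. *)
Lemma phi_ll0 (x y : F) l (mu : row) : (1 <= n)%N ->
  mu *m phi q m n x y l l = 0 <-> uval (mu *m f ^+ l) 0 0 = 0.
Proof.
move=> n0; rewrite phi_ll; split=> [/eqP|muf].
  rewrite scaler_eq0 mulf_eq0 invr_eq0 !(negbTE (qnum_neq0 q_neq0 q_gen _)) //.
    by rewrite /uval => /eqP ->; rewrite mxE.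
  by rewrite -lt0n.
rewrite (_ : _ *m uvec _ _ _ _ _ = 0) ?scaler0 //.
by apply/matrixP=> a b; rewrite !ord1 [RHS]mxE.
Qed.

Lemma phi_S (x y : F) l j (mu : row) : (j <= l)%N ->
  mu *m phi q m n x y l.+1 j = mu *m act_e0 q m n x y *m phi q m n x y l j.
Proof. by move=> jl; rewrite /phi subSn // exprS !mulmxA. Qed.

(** Dual to Delta_l spanning level l. *)
Lemma kills_phi (x y : F) l (mu : row) : (1 <= n)%N -> y != 0 -> (l <= n)%N ->
  (forall j, (j < n)%N -> y != x * q ^ (- m%:Z - n%:Z + 2 * j%:Z)) ->
  (forall j, (j <= l)%N -> mu *m phi q m n x y l j = 0) -> kills mu l.
Proof.
move=> n0 y0 + xy; elim: l mu => [|l IH] mu ln muphi.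
  move=> [|i] [|k] // _; have /(phi_ll0 _ _ _ _ n0) := muphi 0%N isT.
  by rewrite expr0 mulmx1.
have {IH} mue : kills (mu *m act_e0 q m n x y) l.
  by apply: IH (ltnW ln) _ => j jl; rewrite -phi_S // muphi // leqW.
have [lam lamE] := lam_ex (x / y) ln.
(* The two forms agree at u_(l+1,0); both vanish on e_0 of level l, which carries the agreement from
   k to k+1. *)
have muE : kills (mu - uval mu l.+1 0 *: lam) l.+1.
  move=> i k; elim: k i => [|k IHk] i ik.
    rewrite addn0 in ik; rewrite ik.
    rewrite uvalB uvalZ lamE /lam_val addn0 eqxx big_ord0.
    by rewrite mulr1 subrr.
  have /eqP := IHk i.+1 ltac:(lia); have /eqP := mue i k ltac:(lia).
  rewrite uval_e0 // !uvalB !uvalZ !lamE /lam_val addSnnS ik eqxx.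
  rewrite mulf_eq0 invr_eq0 (negbTE q_neq0) /= addr_eq0 => /eqP h1.
  rewrite subr_eq0 => /eqP h2; apply: (mulfI y0); rewrite mulr0 mulrBr.
  by rewrite -[y * _]opprK -h1 h2 big_ord_recr /=; field.
have /(phi_ll0 _ _ _ _ n0) := muphi l.+1 (leqnn _).
(* Evaluating at f^(l+1) Omega_0 shows that the coefficient of [lam] times the product in [lam_fX]
   is 0. *)
have := kills_fX (p := 0) muE (erefl : (0 + 0)%N = 0%N).
rewrite mulmxBl -scalemxAl uvalB uvalZ (lam_fX ln lamE) => /eqP + h.
rewrite h sub0r oppr_eq0 mulf_eq0 => /orP[/eqP mu0|].
  by move=> i k ik; have := muE i k ik; rewrite mu0 scale0r subr0.
rewrite prodf_seq_eq0 => /hasP[t _]; rewrite /= subr_eq0 => /eqP h'.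
have := xy t (leq_trans (ltn_ord t) ln).
rewrite -[X in X != _]mulr1 h' mulrA mulrCA divff // mulr1 eqxx //.
Qed.

End Levels.

(** * The elements of Delta by level, their number, and the criterion *)

Section DeltaSpan.

Set Implicit Arguments.
Unset Strict Implicit.

Variables (F : fieldType) (q : F) (m n : nat) (x y : F).
Hypotheses (q_neq0 : q != 0) (q_gen : forall k : nat, (0 < k)%N -> q ^+ k != 1).
Hypotheses (n_le_m : (n <= m)%N) (n_gt0 : (1 <= n)%N) (y_neq0 : y != 0).

Local Notation row := 'rV[F]_(m.+1 * n.+1).
Local Notation f := (act_f q m n).
Local Notation e0 := (act_e0 q m n x y).
Local Notation kills := (@kills F q m n).
Local Notation uval := (@uval F q m n).

Lemma kills_e0 mu p : kills mu p.+1 -> kills (mu *m e0) p.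
Proof.
move=> mu0 i k ik; rewrite uval_e0 // !mu0 ?mulr0 ?addr0 ?mulr0 //; lia.
Qed.

Lemma kills_e0X mu p t : kills mu (p + t)%N -> kills (mu *m e0 ^+ t) p.
Proof.
elim: t p => [|t IH] p mu0; first by rewrite expr0 mulmx1; rewrite addn0 in mu0.
by rewrite mulmxXSr; apply: kills_e0; apply: IH; rewrite addSnnS.
Qed.

(** Both e_0 and f raise the level by one, so phi_(l,j) lies on level l. *)
Lemma phi_killed mu l j :
  (j <= l)%N -> kills mu l -> mu *m phi q m n x y l j = 0.
Proof.
move=> jl mu0; rewrite /phi /Omega0 mulmxA mulmxA -scalemxAr.
have : kills (mu *m e0 ^+ (l - j) *m f ^+ j) 0.
  by apply: kills_fX => //; apply: kills_e0X; rewrite add0n subnKC.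
move/(_ 0%N 0%N erefl); rewrite /uval /uvec /lower !expr0 !mul1mx => h.
by apply/matrixP=> a b; rewrite mxE !ord1 h mulr0 mxE.
Qed.

Lemma mem_Delta_seqP v : v \in Delta_seq q m n x y <-> exists t l j,
  [/\ v = f ^+ t *m phi q m n x y l j, (j <= l <= n)%N &
    [\/ (l < n)%N /\ t = 0%N, (l < n)%N /\ t = (m + n - 2 * l)%N
      | l = n /\ (t <= m - n)%N]].
Proof.
rewrite /Delta_seq 2!mem_cat; split.
  case/or3P.
  - case/flatten_mapP => l; rewrite mem_iota => /= ln /mapP[j].
    rewrite mem_iota => /= jl ->; exists 0%N, l, j; rewrite expr0 mul1mx.
    by split=> //; [lia | constructor 1].
  - case/flatten_mapP => l + /mapP[_ /mapP[j + ->] ->].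
    rewrite !mem_iota /= => ln jl.
    by exists (m + n - 2 * l)%N, l, j; split=> //; [lia | constructor 2].
  - case/flatten_mapP => t + /mapP[_ /mapP[j + ->] ->].
    rewrite !mem_iota /= => tmn jl.
    by exists t, n, j; split=> //; [lia | constructor 3; split=> //; lia].
case=> t [l [j [-> jl]]]; have jl' : j \in iota 0 l.+1 by rewrite mem_iota; lia.
case=> [[ln ->]|[ln ->]|[ln tmn]].
- apply/orP; left; apply/flatten_mapP; exists l; first by rewrite mem_iota.
  by rewrite expr0 mul1mx map_f.
- apply/or3P; constructor 2; apply/flatten_mapP; exists l.
    by rewrite mem_iota.
  by do 2 apply: map_f.
- apply/or3P; constructor 3; apply/flatten_mapP; exists t.
    by rewrite mem_iota.
  by rewrite -ln; do 2 apply: map_f.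
Qed.

(** The first two unions contribute n(n+1)/2 vectors each, the third (m-n+1)(n+1). *)
Lemma size_Delta_seq : size (Delta_seq q m n x y) = (m.+1 * n.+1)%N.
Proof.
have sum_succ a : (2 * sumn [seq l.+1 | l <- iota 0 a] = a * a.+1)%N.
  elim: a => // a IH.
  rewrite -[X in iota _ X]addn1 iotaD map_cat sumn_cat mulnDr IH /=.
  by lia.
have sizeD l : size (Delta_ q m n x y l) = l.+1 by rewrite size_map size_iota.
rewrite /Delta_seq 2!size_cat size_flatten /shape -map_comp !size_allpairs_dep.
have size_mid a :
    sumn [seq size (Delta_ q m n x y n) | _ <- iota 0 a] = (a * n.+1)%N.
  by rewrite sumnE big_map big_const_seq count_predT
    size_iota iter_addn_0 sizeD mulnC.
rewrite (eq_map (g := succn)) // size_mid addnA addnn -mul2n sum_succ -mulnDl.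
by congr (_ * _)%N; lia.
Qed.

Lemma span_Delta_seqP : <<Delta_seq q m n x y>>%VS = fullv <->
  (forall j : nat, (j < n)%N -> y != x * q ^ (- m%:Z - n%:Z + 2 * j%:Z)).
Proof.
rewrite span_fullP; split=> [ann j jn | xy mu muD].
  apply/eqP => yE.
  have [lam lamE] := lam_ex q_neq0 q_gen n_le_m (x / y) (leqnn n).
  have lam_n p : p <> n -> kills lam p.
    by move=> pn i k ik; rewrite lamE /lam_val ik; case: eqP.
  suff lam0 : lam = 0.
    have := lamE n 0%N; rewrite lam0 uval0 /lam_val addn0 eqxx big_ord0.
    by move/eqP; rewrite eq_sym oner_eq0.
  apply: ann => v /mem_Delta_seqP[t [l [j' [-> jl H]]]].
  have [tl|tl] := eqVneq (l + t)%N n; last first.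
    rewrite mulmxA phi_killed //; first by lia.
    by apply: kills_fX => //; apply: lam_n; apply/eqP.
  (* Only t = 0, l = n reaches level n: for l < n, the other powers of f lead to level l < n or
     m+n-l > n. *)
  have -> : t = 0%N by case: H => -[]; lia.
  have -> : l = n by case: H => -[]; lia.
  (* For j' = n the factor of index j in the product vanishes; for j' < n the outermost operator is
     e_0. *)
  rewrite expr0 mul1mx; have [->|jn'] := eqVneq j' n.
    apply/phi_ll0 => //; rewrite (lam_fX q_neq0 q_gen n_le_m _ lamE) //.
    rewrite (bigD1 (Ordinal jn)) //=.
    have x0 : x != 0 by apply: contraNneq y_neq0 => x0; rewrite yE x0 mul0r.
    rewrite [X in x / X]yE [X in (1 - X)](_ : _ = 1) ?subrr ?mul0r //.
    by field; rewrite x0 expfz_neq0.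
  have j'n : (j' <= n.-1)%N by lia.
  have := phi_S q x y lam j'n; rewrite (prednK n_gt0) => ->.
  by rewrite (lam_e0 _ _ _ lamE) ?mul0mx.
have muf t l : (l <= n)%N ->
    [\/ (l < n)%N /\ t = 0%N, (l < n)%N /\ t = (m + n - 2 * l)%N
      | l = n /\ (t <= m - n)%N] -> kills (mu *m f ^+ t) l.
  move=> ln H; apply: (kills_phi q_neq0 q_gen n_le_m n_gt0 y_neq0 ln
    xy) => j jl.
  rewrite -mulmxA; apply: muD; apply/mem_Delta_seqP; exists t, l, j.
  by rewrite jl ln.
apply: (kills_eq0 q_neq0 q_gen) => p.
(* Levels p < n use t = 0; n <= p <= m come from level n with t = p - n; m < p <= m + n from level
   m+n-p; higher levels are zero. *)
have [pn|np] := ltnP p n.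
  by rewrite -[mu]mulmx1; apply: (muf 0%N); [lia | constructor 1].
have [pm|mp] := leqP p m.
  rewrite -(subnKC np); apply: kills_fX_inv => //; apply: muf => //.
  by constructor 3; split=> //; lia.
have [pmn|mnp] := leqP p (m + n)%N; last first.
  by move=> i k ik; apply: uval_out => //; lia.
have -> : p = (m + n - (m + n - p))%N by lia.
apply: kills_fX_inv_high => //; first by lia.
by apply: muf; [lia | constructor 2; lia].
Qed.

(** A spanning family of at most (m+1)(n+1) vectors is a basis, and [undup] changes neither the span
    nor this bound. *)
Lemma basis_DeltaP : basis_of fullv (Delta q m n x y) <->
  (forall j : nat, (j < n)%N -> y != x * q ^ (- m%:Z - n%:Z + 2 * j%:Z)).
Proof.
have spanU : <<Delta q m n x y>>%VS = <<Delta_seq q m n x y>>%VS.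
  by apply: eq_span => v; rewrite mem_undup.
rewrite -span_Delta_seqP basisEdim spanU dimvf dim_matrix mulr1.
rewrite (leq_trans (size_undup _)) ?size_Delta_seq // andbT.
by split=> [h|->]; [apply/eqP; rewrite eqEsubv subvf | exact: subvv].
Qed.

End DeltaSpan.

Theorem theorem3p1 (R : realType) (m n : nat) (q x y : complex R)
    (hmn : (1 <= n <= m)%N)
    (hq0 : q != 0)
    (hq : forall k : nat, (0 < k)%N -> q ^+ k != 1)
    (hx : x != 0) (hy : y != 0) :
  basis_of (fullv : {vspace 'cV[complex R]_(m.+1 * n.+1)}) (Delta q m n x y) <->
  (forall j : nat, (j < n)%N -> y != x * q ^ (- m%:Z - n%:Z + 2 * j%:Z)).
Proof. by case/andP: hmn => n0 nm; exact: basis_DeltaP. Qed.
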